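(* Let $\{\mathbb{X}_n\}_{n\in\mathbb{N}}$ be a sequence of non-trivial normed linear spaces over $\mathbb{K}$. The space $\bigoplus_1\mathbb{X}_n$ has no non-zero left-symmetric point, and $x=\{x_n\}_{n\in\mathbb{N}}\in\bigoplus_1\mathbb{X}_n$ is a right-symmetric point if and only if there exists $n_0\in\mathbb{N}$ such that $x_n=0$ whenever $n\neq n_0$ and $x_{n_0}\in\mathbb{X}_{n_0}$ is right-symmetric.
   Context: $\mathbb{K}=\mathbb{R}$ or $\mathbb{C}$; non-trivial means of dimension more than $0$. $\bigoplus_1\mathbb{X}_n$ is the space of sequences $\{x_n\}$ with $x_n\in\mathbb{X}_n$ and $\sum_n\|x_n\|<\infty$, with norm $\|\{x_n\}\|_1=\sum_n\|x_n\|$. In a normed space $\mathbb{X}$, $x\perp_By$ means $\|x+\lambda y\|\ge\|x\|$ for every scalar $\lambda\in\mathbb{K}$. A point $x\in\mathbb{X}$ is left-symmetric if $x\perp_By\Rightarrow y\perp_Bx$ for every $y\in\mathbb{X}$, and right-symmetric if $y\perp_Bx\Rightarrow x\perp_By$ for every $y\in\mathbb{X}$. *)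

(* Defs.v *)
(** Stdlib world: concrete reals and Coquelicot's normed modules. *)
From Stdlib Require Import Reals Lra FunctionalExtensionality ProofIrrelevance.
From Coquelicot Require Import Coquelicot.
Set Implicit Arguments.
Open Scope R_scope.

(** [NormedModule] only postulates [norm (scal l x) <= abs l * norm x]; over
    [R_AbsRing] and [C_AbsRing] equality follows by inverting [l], so its
    instances there are the usual normed linear spaces. *)
Section BirkhoffJames.
Context {K : AbsRing} {V : NormedModule K}.

Definition bj_orthogonal (x y : V) : Prop :=
  forall l : K, norm (plus x (scal l y)) >= norm x.

Definition left_symmetric (x : V) : Prop :=
  forall y : V, bj_orthogonal x y -> bj_orthogonal y x.

Definition right_symmetric (x : V) : Prop :=
  forall y : V, bj_orthogonal y x -> bj_orthogonal x y.

End BirkhoffJames.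

Definition nontrivial {K : AbsRing} (V : NormedModule K) : Prop :=
  exists v : V, v <> zero.

Section L1Sum.
Context {K : AbsRing}.
Variable X : nat -> NormedModule K.

(** All terms being nonnegative, [ex_series] says exactly that the sum of the
    norms is finite, and [Series] is then its value. *)
Definition norm_summable (x : forall n, X n) : Prop :=
  ex_series (fun n => norm (x n)).

Record l1_sum : Type := L1Sum {
  l1_seq :> forall n, X n;
  l1_summable : norm_summable l1_seq }.

Definition l1_norm (x : l1_sum) : R := Series (fun n => norm (x n)).

Lemma l1_ext (x y : l1_sum) : (forall n, x n = y n) -> x = y.
Proof.
destruct x as [x hx], y as [y hy]; simpl; intros e.
assert (E : x = y) by (apply functional_extensionality_dep; exact e).
subst y; f_equal; apply proof_irrelevance.
Qed.

Lemma ex_series_dominated (a b : nat -> R) :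
  (forall n, 0 <= a n <= b n) -> ex_series b -> ex_series a.
Proof.
intros H Hb; apply (@ex_series_le R_AbsRing R_CompleteNormedModule a b); auto.
intros n; change (Rabs (a n) <= b n).
rewrite Rabs_pos_eq; apply H.
Qed.

Lemma norm_summable_zero : norm_summable (fun n => zero).
Proof.
apply (ex_series_ext (fun _ : nat => 0)).
- intros n; symmetry; apply norm_zero.
- apply (@ex_series_dominated _ (fun n => (1 / 2) ^ n)).
  + intros n; split; [lra | apply pow_le; lra].
  + apply ex_series_geom; rewrite Rabs_pos_eq; lra.
Qed.

Lemma norm_summable_plus (x y : l1_sum) :
  norm_summable (fun n => plus (x n) (y n)).
Proof.
apply (@ex_series_dominated _ (fun n => norm (x n) + norm (y n))).
- intros n; split; [apply norm_ge_0 | apply norm_triangle].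
- exact (ex_series_plus _ _ (l1_summable x) (l1_summable y)).
Qed.

Lemma norm_summable_opp (x : l1_sum) : norm_summable (fun n => opp (x n)).
Proof.
apply (ex_series_ext (fun n => norm (x n))); [| exact (l1_summable x)].
intros n; symmetry; apply norm_opp.
Qed.

Lemma norm_summable_scal (a : K) (x : l1_sum) :
  norm_summable (fun n => scal a (x n)).
Proof.
apply (@ex_series_dominated _ (fun n => abs a * norm (x n))).
- intros n; split; [apply norm_ge_0 | apply norm_scal].
- exact (ex_series_scal_l (abs a) _ (l1_summable x)).
Qed.

Definition l1_zero : l1_sum := L1Sum norm_summable_zero.
Definition l1_plus (x y : l1_sum) : l1_sum := L1Sum (norm_summable_plus x y).
Definition l1_opp (x : l1_sum) : l1_sum := L1Sum (norm_summable_opp x).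
Definition l1_scal (a : K) (x : l1_sum) : l1_sum :=
  L1Sum (norm_summable_scal a x).

Lemma l1_plus_comm (x y : l1_sum) : l1_plus x y = l1_plus y x.
Proof. apply l1_ext; intros n; apply plus_comm. Qed.

Lemma l1_plus_assoc (x y z : l1_sum) :
  l1_plus x (l1_plus y z) = l1_plus (l1_plus x y) z.
Proof. apply l1_ext; intros n; apply plus_assoc. Qed.

Lemma l1_plus_zero_r (x : l1_sum) : l1_plus x l1_zero = x.
Proof. apply l1_ext; intros n; apply plus_zero_r. Qed.

Definition l1_AbelianMonoid_mixin := AbelianMonoid.Mixin l1_sum
  l1_plus l1_zero l1_plus_comm l1_plus_assoc l1_plus_zero_r.
Canonical l1_AbelianMonoid :=
  AbelianMonoid.Pack l1_sum l1_AbelianMonoid_mixin l1_sum.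

Lemma l1_plus_opp_r (x : l1_sum) : plus x (l1_opp x) = zero.
Proof. apply l1_ext; intros n; exact (plus_opp_r (x n)). Qed.

Definition l1_AbelianGroup_mixin :=
  AbelianGroup.Mixin l1_AbelianMonoid l1_opp l1_plus_opp_r.
Canonical l1_AbelianGroup := AbelianGroup.Pack l1_sum
  (AbelianGroup.Class l1_sum l1_AbelianMonoid_mixin l1_AbelianGroup_mixin)
  l1_sum.

Lemma l1_scal_assoc (a b : K) (x : l1_sum) :
  l1_scal a (l1_scal b x) = l1_scal (mult a b) x.
Proof. apply l1_ext; intros n; apply scal_assoc. Qed.

Lemma l1_scal_one (x : l1_sum) : l1_scal one x = x.
Proof. apply l1_ext; intros n; apply scal_one. Qed.

Lemma l1_scal_distr_l (a : K) (x y : l1_sum) :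
  l1_scal a (plus x y) = plus (l1_scal a x) (l1_scal a y).
Proof. apply l1_ext; intros n; exact (scal_distr_l a (x n) (y n)). Qed.

Lemma l1_scal_distr_r (a b : K) (x : l1_sum) :
  l1_scal (plus a b) x = plus (l1_scal a x) (l1_scal b x).
Proof. apply l1_ext; intros n; exact (scal_distr_r a b (x n)). Qed.

Definition l1_ModuleSpace_mixin := ModuleSpace.Mixin K l1_AbelianGroup
  l1_scal l1_scal_assoc l1_scal_one l1_scal_distr_l l1_scal_distr_r.
Canonical l1_ModuleSpace := ModuleSpace.Pack K l1_sum
  (ModuleSpace.Class K l1_sum _ l1_ModuleSpace_mixin) l1_sum.

Lemma l1_norm_triangle (x y : l1_sum) :
  l1_norm (plus x y) <= l1_norm x + l1_norm y.
Proof.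
unfold l1_norm.
rewrite <- (Series_plus _ _ (l1_summable x) (l1_summable y)).
apply Series_le.
- intros n; split; [apply norm_ge_0 | exact (norm_triangle (x n) (y n))].
- exact (ex_series_plus _ _ (l1_summable x) (l1_summable y)).
Qed.

Lemma l1_norm_scal (a : K) (x : l1_sum) :
  l1_norm (scal a x) <= abs a * l1_norm x.
Proof.
unfold l1_norm; rewrite <- Series_scal_l.
apply Series_le.
- intros n; split; [apply norm_ge_0 | exact (norm_scal a (x n))].
- exact (ex_series_scal_l (abs a) _ (l1_summable x)).
Qed.

Lemma l1_norm_zero : l1_norm zero = 0.
Proof.
transitivity (Series (fun n => 0 * norm (l1_zero n))).
- apply Series_ext; intros n; simpl; rewrite norm_zero; ring.
- rewrite Series_scal_l; ring.
Qed.

Lemma l1_norm_opp (x : l1_sum) : l1_norm (opp x) = l1_norm x.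
Proof. apply Series_ext; intros n; exact (norm_opp (x n)). Qed.

Lemma norm_le_l1_norm (x : l1_sum) (n : nat) : norm (x n) <= l1_norm x.
Proof.
apply Rle_trans with (sum_n (fun k => norm (x k)) n).
- destruct n as [|n]; [rewrite sum_O; lra |].
  rewrite sum_Sn.
  assert (H : 0 <= sum_n (fun k => norm (x k)) n).
  { rewrite sum_n_Reals; apply cond_pos_sum; intros k; apply norm_ge_0. }
  change (norm (x (S n)) <= sum_n (fun k => norm (x k)) n + norm (x (S n))).
  lra.
- apply (is_lim_seq_incr_compare (sum_n (fun k => norm (x k)))).
  + exact (Series_correct _ (l1_summable x)).
  + intros k; rewrite sum_Sn.
    change (sum_n (fun k => norm (x k)) k
            <= sum_n (fun k => norm (x k)) k + norm (x (S k))).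
    pose proof (norm_ge_0 (x (S k))); lra.
Qed.

Lemma l1_norm_eq_zero (x : l1_sum) : l1_norm x = 0 -> x = zero.
Proof.
intros H; apply l1_ext; intros n; apply norm_eq_zero.
pose proof (norm_le_l1_norm x n); pose proof (norm_ge_0 (x n)); lra.
Qed.

Definition l1_ball (x : l1_sum) (eps : R) (y : l1_sum) : Prop :=
  l1_norm (minus y x) < eps.

Lemma l1_ball_center (x : l1_sum) (eps : posreal) : l1_ball x eps x.
Proof.
unfold l1_ball; rewrite minus_eq_zero.
apply Rle_lt_trans with 0; [right; exact l1_norm_zero | apply cond_pos].
Qed.

Lemma l1_ball_sym (x y : l1_sum) (eps : R) :
  l1_ball x eps y -> l1_ball y eps x.
Proof.
unfold l1_ball; rewrite <- (opp_minus y x), l1_norm_opp; auto.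
Qed.

Lemma l1_ball_triangle (x y z : l1_sum) (e1 e2 : R) :
  l1_ball x e1 y -> l1_ball y e2 z -> l1_ball x (e1 + e2) z.
Proof.
unfold l1_ball; intros H1 H2.
apply Rle_lt_trans with (l1_norm (minus z y) + l1_norm (minus y x)).
- rewrite (minus_trans y z x); exact (l1_norm_triangle _ _).
- lra.
Qed.

Definition l1_UniformSpace_mixin := UniformSpace.Mixin l1_sum
  l1_zero l1_ball l1_ball_center l1_ball_sym l1_ball_triangle.
Canonical l1_UniformSpace :=
  UniformSpace.Pack l1_sum l1_UniformSpace_mixin l1_sum.
Canonical l1_NormedModuleAux := NormedModuleAux.Pack K l1_sum
  (NormedModuleAux.Class K l1_sum
    (ModuleSpace.class K l1_ModuleSpace) l1_UniformSpace_mixin) l1_sum.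

Lemma l1_norm_compat1 (x y : l1_sum) (eps : R) :
  l1_norm (minus y x) < eps -> ball x eps y.
Proof. auto. Qed.

Lemma l1_norm_compat2 (x y : l1_sum) (eps : posreal) :
  ball x eps y -> l1_norm (minus y x) < 1 * eps.
Proof. rewrite Rmult_1_l; auto. Qed.

Definition l1_NormedModule_mixin := NormedModule.Mixin K l1_NormedModuleAux
  l1_norm 1 l1_norm_triangle l1_norm_scal l1_norm_compat1 l1_norm_compat2
  l1_norm_eq_zero.
Canonical l1_NormedModule : NormedModule K := NormedModule.Pack K l1_sum
  (NormedModule.Class K l1_sum
    (NormedModuleAux.class K l1_NormedModuleAux) l1_NormedModule_mixin) l1_sum.

End L1Sum.

(* Main.v *)
(** Call [u] and [z] an l1 pair when [norm (s u + t z) = |s| norm u + |t| norm z]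
    for all scalars; disjointly supported elements of the l1 sum form such pairs.

    Let [x <> 0]. If some coordinate of [x] vanishes, a vector [w] supported there
    with [norm w = norm x] gives [x _|_ x + w], whereas [x + w] gets shorter when
    [x] is subtracted. Otherwise [x = u + z] with [u] one of the first two
    coordinates and [z] the rest; [norm u = norm z] cannot hold for both choices,
    as this would kill the third coordinate. Then [x _|_ u - (norm u / norm z) z],
    but not conversely.

    If two coordinates of [x] are nonzero, let [u] be the one of smaller norm and
    [z] the rest, so that [norm u <= norm z]: then [- u _|_ x], whereas
    [x - u = z] is shorter than [x]. *)
Require Import Defs.
From Stdlib Require Import Reals Lra Lia Classical Peano_dec Compare_dec.
From Coquelicot Require Import Coquelicot.

(** * Real and complex scalars under one interface *)

(** All scalars built from norms are real; [iota] places them in [K], so that one argument serves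
    both fields. *)
Record real_embedding {K : AbsRing} (iota : R -> K) : Prop := {
  abs_emb : forall r, abs (iota r) = Rabs r;
  emb_one : iota 1 = one;
  emb_plus : forall r s, iota (r + s) = plus (iota r) (iota s);
  emb_mult : forall r s, iota (r * s) = mult (iota r) (iota s) }.

(** The condition on [abs t] is stated separately because [abs] on an [AbsRing] is only
    submultiplicative. *)
Definition abs_invertible (K : AbsRing) : Prop :=
  forall s : K, s <> zero -> exists t : K, mult t s = one /\ abs t * abs s = 1.

Lemma real_embedding_R : real_embedding (K := R_AbsRing) (fun r => r).
Proof. now split. Qed.

Lemma real_embedding_C : real_embedding (K := C_AbsRing) RtoC.
Proof.
split.
- exact Cmod_R.
- reflexivity.
- exact RtoC_plus.
- exact RtoC_mult.
Qed.

Lemma abs_invertible_R : abs_invertible R_AbsRing.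
Proof.
intros s hs; change (s <> 0) in hs; exists (/ s); split.
- change (/ s * s = 1); field; exact hs.
- change (Rabs (/ s) * Rabs s = 1).
  rewrite <- Rabs_mult, Rinv_l, Rabs_R1; auto.
Qed.

Lemma abs_invertible_C : abs_invertible C_AbsRing.
Proof.
intros s hs; change (s <> RtoC 0) in hs.
assert (E : Cmult (Cinv s) s = RtoC 1) by (apply Cinv_l; exact hs).
exists (Cinv s); split; [exact E |].
change (Cmod (Cinv s) * Cmod s = 1).
rewrite <- Cmod_mult, E; apply Cmod_1.
Qed.

(** * Scalar identities and homogeneity of the norm *)

Section NormedModuleFacts.
Context {K : AbsRing} {iota : R -> K}.
Context (hiota : real_embedding iota) (hinv : abs_invertible K).

(** [plus] and [zero] on [K] occur with two convertible but syntactically distinct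
    monoid structures, which [rewrite] and [lra] do not identify. *)
Ltac same_monoid :=
  change (Ring.AbelianMonoid (AbsRing.Ring K)) with (AbsRing.AbelianMonoid K) in *.

Lemma emb_zero : iota 0 = zero.
Proof. apply abs_eq_zero; rewrite (abs_emb _ hiota); apply Rabs_R0. Qed.

(** Instances of [scal_distr_r] and its siblings stated with the structures inferred
    from [K : AbsRing], without which [rewrite] does not match them. *)
Lemma scal_plus_l (V : NormedModule K) (s t : K) (v : V) :
  scal (plus s t) v = plus (scal s v) (scal t v).
Proof. exact (scal_distr_r s t v). Qed.

Lemma scal_plus_r (V : NormedModule K) (s : K) (v w : V) :
  scal s (plus v w) = plus (scal s v) (scal s w).
Proof. exact (scal_distr_l s v w). Qed.

Lemma scal_opp1 (V : NormedModule K) (v : V) : scal (opp one : K) v = opp v.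
Proof. exact (scal_opp_one v). Qed.

Lemma mult_plus_l (s t r : K) : mult (plus s t) r = @plus K (mult s r) (mult t r).
Proof. exact (mult_distr_r s t r). Qed.

Lemma mult_plus_r (s t r : K) : mult s (plus t r) = @plus K (mult s t) (mult s r).
Proof. exact (mult_distr_l s t r). Qed.

Lemma scal_zero (V : NormedModule K) (v : V) : scal (zero : K) v = zero.
Proof. exact (scal_zero_l v). Qed.

Lemma scal_zero_right (V : NormedModule K) (s : K) : scal s (zero : V) = zero.
Proof. exact (scal_zero_r s). Qed.

Lemma mult_zero (s : K) : mult s zero = zero.
Proof. exact (mult_zero_r s). Qed.

Lemma abs_plus_ge (s t : K) : abs s <= abs (plus s t) + abs t.
Proof.
rewrite <- (abs_opp t).
replace s with (plus (plus s t) (opp t)) at 1; [exact (abs_triangle _ _) |].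
rewrite <- plus_assoc; transitivity (plus s zero); [| exact (plus_zero_r s)].
f_equal; exact (plus_opp_r t).
Qed.

(** For [s] nonzero with inverse [t], the bound [norm_scal] applied to [v = t (s v)] gives the
    reverse inequality. *)
Lemma norm_scal_eq (V : NormedModule K) (s : K) (v : V) :
  norm (scal s v) = abs s * norm v.
Proof.
apply Rle_antisym; [apply norm_scal |].
destruct (classic (s = zero)) as [-> | hs].
- rewrite abs_zero, Rmult_0_l; apply norm_ge_0.
- destruct (hinv s hs) as [t [hts habs]].
  pose proof (norm_scal t (scal s v)) as H.
  rewrite scal_assoc, hts, scal_one in H.
  apply Rle_trans with (abs s * (abs t * norm (scal s v))).
  + apply Rmult_le_compat_l; [apply abs_ge_0 | exact H].
  + replace (abs s * (abs t * norm (scal s v)))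
      with ((abs t * abs s) * norm (scal s v)) by ring.
    rewrite habs; lra.
Qed.

(** * Symmetry in the span of an l1 pair *)

Section L1Pair.
Context {V : NormedModule K}.

Lemma norm_gt_0 (v : V) : v <> zero -> 0 < norm v.
Proof.
intros hv; destruct (norm_ge_0 v) as [H | H]; [exact H |].
exfalso; apply hv, norm_eq_zero; auto.
Qed.

Definition l1_pair (u z : V) : Prop :=
  forall s t : K,
    norm (plus (scal s u) (scal t z)) = abs s * norm u + abs t * norm z.

Lemma norm_l1_pair (u z : V) : l1_pair u z ->
  norm (plus u z) = norm u + norm z.
Proof.
intros h; pose proof (h one one) as E.
rewrite !scal_one, abs_one, !Rmult_1_l in E; exact E.
Qed.

(** Puts a perturbed vector in the form whose norm [l1_pair] computes. *)
Lemma comb_plus_scal (u z : V) (p q s t l : K) :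
  plus (plus (scal p u) (scal q z)) (scal l (plus (scal s u) (scal t z)))
  = plus (scal (plus p (mult l s)) u) (scal (plus q (mult l t)) z).
Proof.
rewrite scal_distr_l, !scal_assoc, !scal_plus_l, <- !plus_assoc.
f_equal; rewrite !plus_assoc; f_equal; apply plus_comm.
Qed.

(** Moves a norm inside [abs], so that weighted sums can be bounded by the triangle inequality in
    [K]. *)
Lemma abs_scaled_ge (s : K) (r : R) : 0 <= r ->
  abs (mult s (iota r)) <= abs s * r.
Proof.
intros hr; pose proof (abs_mult s (iota r)) as H.
rewrite (abs_emb _ hiota), (Rabs_pos_eq r hr) in H; exact H.
Qed.

Lemma l1_pair_not_left_symmetric (x w : V) :
  l1_pair x w -> x <> zero -> w <> zero -> ~ left_symmetric x.
Proof.
intros h hx hw hsym.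
pose proof (norm_gt_0 x hx) as hx0; pose proof (norm_gt_0 w hw) as hw0.
set (c := norm x / norm w).
assert (hc : 0 < c) by (apply Rdiv_lt_0_compat; assumption).
assert (hcw : c * norm w = norm x) by (unfold c; field; lra).
set (y := plus (scal (iota 1) x) (scal (iota c) w)).
assert (Ex : x = plus (scal (iota 1) x) (scal (iota 0) w)).
{ rewrite emb_zero, (emb_one _ hiota), scal_one, scal_zero.
  symmetry; apply plus_zero_r. }
(* Since [c * norm w = norm x], the norm of [x + l y] is [(|1 + l| + |l|) norm x], at least
   [norm x]. *)
assert (Exy : bj_orthogonal x y).
{ intros l; unfold y; rewrite Ex at 1; rewrite comb_plus_scal, h.
  rewrite (emb_one _ hiota), mult_one_r, emb_zero, plus_zero_l.
  assert (H : abs (mult (mult l (iota c)) (iota (norm w)))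
              <= abs (mult l (iota c)) * norm w)
    by (apply abs_scaled_ge; lra).
  rewrite <- mult_assoc, <- (emb_mult _ hiota), hcw in H.
  assert (H1 : abs (mult (plus one l) (iota (norm x)))
               <= abs (plus one l) * norm x) by (apply abs_scaled_ge; lra).
  rewrite mult_plus_l, mult_one_l in H1.
  pose proof (abs_plus_ge (iota (norm x)) (mult l (iota (norm x)))) as H2.
  rewrite (abs_emb _ hiota), Rabs_pos_eq in H2 by lra.
  same_monoid; lra. }
(* [y - x = c w] has norm [norm x], whereas [norm y = 2 norm x]. *)
pose proof (hsym y Exy (iota (-1))) as H; unfold y in H.
rewrite Ex in H at 2; rewrite comb_plus_scal, !h in H.
rewrite <- !(emb_mult _ hiota), <- !(emb_plus _ hiota), !(abs_emb _ hiota) in H.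
replace (1 + -1 * 1) with 0 in H by ring.
replace (c + -1 * 0) with c in H by ring.
rewrite Rabs_R0, Rabs_R1, (Rabs_pos_eq c) in H; lra.
Qed.

Lemma l1_pair_plus_not_left_symmetric (u z : V) :
  l1_pair u z -> u <> zero -> z <> zero -> norm u <> norm z ->
  ~ left_symmetric (plus u z).
Proof.
intros h hu hz hne hsym.
pose proof (norm_gt_0 u hu) as hu0; pose proof (norm_gt_0 z hz) as hz0.
set (c := norm u / norm z).
assert (hc : 0 < c) by (apply Rdiv_lt_0_compat; assumption).
assert (hcz : c * norm z = norm u) by (unfold c; field; lra).
assert (Ex : plus u z = plus (scal (iota 1) u) (scal (iota 1) z))
  by (rewrite (emb_one _ hiota), !scal_one; reflexivity).
set (y := plus (scal (iota 1) u) (scal (iota (- c)) z)).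
assert (Exy : bj_orthogonal (plus u z) y).
{ intros l; rewrite (norm_l1_pair u z h), Ex; unfold y.
  rewrite comb_plus_scal, h.
  rewrite (emb_one _ hiota), mult_one_r.
  (* the two coefficients, weighted by [norm u] and [norm z], have a sum free of [l] *)
  assert (H1 : abs (mult (plus one l) (iota (norm u)))
               <= abs (plus one l) * norm u) by (apply abs_scaled_ge; lra).
  assert (H2 : abs (mult (plus one (mult l (iota (- c)))) (iota (norm z)))
               <= abs (plus one (mult l (iota (- c)))) * norm z)
    by (apply abs_scaled_ge; lra).
  rewrite mult_plus_l, mult_one_l in H1.
  rewrite mult_plus_l, mult_one_l, <- mult_assoc, <- (emb_mult _ hiota) in H2.
  replace (- c * norm z) with (- norm u) in H2 by lra.
  pose proof (abs_triangle (plus (iota (norm u)) (mult l (iota (norm u))))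
                (plus (mult l (iota (- norm u))) (iota (norm z)))) as H3.
  rewrite <- plus_assoc, (plus_assoc (mult l (iota (norm u)))),
    <- mult_plus_r, <- (emb_plus _ hiota), Rplus_opp_r, emb_zero, mult_zero,
    plus_zero_l, <- (emb_plus _ hiota), (abs_emb _ hiota), Rabs_pos_eq,
    (plus_comm (mult l (iota (- norm u)))) in H3 by lra.
  same_monoid; lra. }
(* The converse orthogonality, tested at real scalars only; the right side is [norm y], as
   [c * norm z = norm u]. *)
assert (H : forall r, Rabs (1 + r) * norm u + Rabs (- c + r) * norm z
                      >= 2 * norm u).
{ intros r; pose proof (hsym y Exy (iota r)) as H.
  rewrite Ex in H; unfold y in H; rewrite comb_plus_scal, !h in H.
  rewrite <- !(emb_mult _ hiota), <- !(emb_plus _ hiota), !(abs_emb _ hiota),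
    Rabs_R1, Rabs_Ropp, (Rabs_pos_eq c), !Rmult_1_r in H by lra.
  lra. }
destruct (Rdichotomy _ _ hne) as [hlt | hgt].
(* Taking [r = c] cancels the [z] term and leaves [(1 + c) norm u], with [c < 1]. *)
- pose proof (H c) as Hc.
  rewrite Rplus_opp_l, Rabs_R0, Rabs_pos_eq in Hc by lra.
  assert (c < 1) by (apply Rmult_lt_reg_r with (norm z); lra).
  assert (c * norm u < 1 * norm u) by (apply Rmult_lt_compat_r; lra).
  lra.
(* Taking [r = -1] cancels the [u] term and leaves [norm z + norm u], less than [2 norm u]. *)
- pose proof (H (-1)) as Hc.
  rewrite Rplus_opp_r, Rabs_R0, Rabs_left in Hc by lra.
  lra.
Qed.

Lemma l1_pair_plus_not_right_symmetric (u z : V) :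
  l1_pair u z -> u <> zero -> norm u <= norm z -> ~ right_symmetric (plus u z).
Proof.
intros h hu hle hsym.
pose proof (norm_gt_0 u hu) as hu0.
assert (Hyx : bj_orthogonal (opp u) (plus u z)).
{ intros l; rewrite norm_opp.
  assert (E : norm (plus (opp u) (scal l (plus u z)))
              = abs (@plus K (opp one) l) * norm u + abs l * norm z).
  { rewrite <- h, scal_plus_r, scal_plus_l, scal_opp1; f_equal.
    exact (plus_assoc (opp u) (scal l u) (scal l z)). }
  apply Rle_ge, Rle_trans with (2 := Req_le _ _ (eq_sym E)).
  (* As [norm z >= norm u], it suffices that [|l - 1| + |l| >= 1]. *)
  pose proof (abs_plus_ge (opp one) l) as H.
  rewrite abs_opp_one in H.
  pose proof (Rmult_le_compat_l (abs l) _ _ (abs_ge_0 l) hle).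
  pose proof (Rmult_le_compat_r (norm u) _ _ (norm_ge_0 u) H).
  same_monoid; lra. }
pose proof (hsym _ Hyx one) as H.
assert (E : plus (plus u z) (scal one (opp u)) = z).
{ rewrite scal_one, (plus_comm u z), <- plus_assoc.
  transitivity (plus z zero); [| apply plus_zero_r].
  f_equal; exact (plus_opp_r u). }
rewrite E, (norm_l1_pair u z h) in H; lra.
Qed.

End L1Pair.

(** * Splitting an element of the l1 sum into one coordinate and the rest *)

Section L1SumSymmetry.
Context {X : nat -> NormedModule K}.

Lemma norm_plus_disjoint (u z : l1_sum X) :
  (forall n, u n = zero \/ z n = zero) ->
  norm (plus u z) = norm u + norm z.
Proof.
intros h.
change (l1_norm (plus u z) = l1_norm u + l1_norm z).
unfold l1_norm.
rewrite <- (Series_plus _ _ (l1_summable u) (l1_summable z)).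
apply Series_ext; intros n.
change (norm (plus (u n) (z n)) = norm (u n) + norm (z n)).
destruct (h n) as [-> | ->].
- rewrite plus_zero_l, norm_zero; ring.
- rewrite plus_zero_r, norm_zero; ring.
Qed.

Lemma disjoint_l1_pair (u z : l1_sum X) :
  (forall n, u n = zero \/ z n = zero) -> l1_pair u z.
Proof.
intros h s t; rewrite norm_plus_disjoint.
- now rewrite !norm_scal_eq.
- intros n.
  change (scal s (u n) = zero \/ scal t (z n) = zero).
  destruct (h n) as [-> | ->]; rewrite scal_zero_right; auto.
Qed.

(** The spaces vary with the index, so [v] must be transported along [k = n]; uniqueness of identity
    proofs on [nat] removes the transport at [n = k]. *)
Definition single_seq (k : nat) (v : X k) (n : nat) : X n :=
  match Nat.eq_dec k n with
  | left e => eq_rect k (fun m => X m) v n e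
  | right _ => zero
  end.

Lemma single_seq_same (k : nat) (v : X k) : single_seq k v k = v.
Proof.
unfold single_seq; destruct (Nat.eq_dec k k) as [e | ne]; [| now destruct ne].
now rewrite (UIP_nat _ _ e eq_refl).
Qed.

Lemma single_seq_other (k : nat) (v : X k) (n : nat) :
  n <> k -> single_seq k v n = zero.
Proof.
intros hn; unfold single_seq.
destruct (Nat.eq_dec k n) as [e | ne]; [now destruct hn | reflexivity].
Qed.

Lemma is_series_norm_single (k : nat) (v : X k) :
  is_series (fun n => norm (single_seq k v n)) (norm v).
Proof.
set (a := fun n => norm (single_seq k v n)).
assert (a0 : forall n, n <> k -> a n = 0).
{ intros n hn; unfold a; rewrite single_seq_other by exact hn; apply norm_zero. }
assert (ak : a k = norm v) by (unfold a; now rewrite single_seq_same).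
(* The partial sums jump from 0 to [norm v] at index [k] and stay there. *)
assert (H : forall n, sum_n a n = if le_lt_dec k n then norm v else 0).
{ induction n as [| n IH].
  - rewrite sum_O; destruct (le_lt_dec k 0).
    + replace 0%nat with k by lia; exact ak.
    + apply a0; lia.
  - rewrite sum_Sn, IH.
    change ((if le_lt_dec k n then norm v else 0) + a (S n)
            = if le_lt_dec k (S n) then norm v else 0).
    destruct (le_lt_dec k n), (le_lt_dec k (S n)); try lia.
    + rewrite a0 by lia; ring.
    + replace (S n) with k by lia; rewrite ak; ring.
    + rewrite a0 by lia; ring. }
apply (is_lim_seq_ext_loc (fun _ => norm v) (sum_n a) (norm v)).
- exists k; intros n hn; rewrite H; destruct (le_lt_dec k n); [reflexivity | lia].
- apply is_lim_seq_const.
Qed.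

Definition single (k : nat) (v : X k) : l1_sum X :=
  @L1Sum K X (single_seq k v) (ex_intro _ _ (is_series_norm_single k v)).

Lemma norm_single (k : nat) (v : X k) : norm (single k v) = norm v.
Proof. exact (is_series_unique _ _ (is_series_norm_single k v)). Qed.

Lemma single_neq_zero (k : nat) (v : X k) : v <> zero -> single k v <> zero.
Proof.
intros hv E; apply hv, norm_eq_zero.
rewrite <- norm_single, E; apply l1_norm_zero.
Qed.

Lemma plus_single_scal (k : nat) (v w : X k) (l : K) :
  plus (single k v) (scal l (single k w)) = single k (plus v (scal l w)).
Proof.
apply l1_ext; intros n.
change (plus (single_seq k v n) (scal l (single_seq k w n))
        = single_seq k (plus v (scal l w)) n).
destruct (Nat.eq_dec n k) as [-> | hn].
- now rewrite !single_seq_same.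
- rewrite !single_seq_other, scal_zero_right by exact hn; apply plus_zero_l.
Qed.

Definition rest (k : nat) (x : l1_sum X) : l1_sum X :=
  minus x (single k (x k)).

Lemma rest_same (k : nat) (x : l1_sum X) : rest k x k = zero.
Proof.
change (minus (x k) (single_seq k (x k) k) = zero).
rewrite single_seq_same; apply minus_eq_zero.
Qed.

Lemma rest_other (k : nat) (x : l1_sum X) (n : nat) :
  n <> k -> rest k x n = x n.
Proof.
intros hn; change (minus (x n) (single_seq k (x k) n) = x n).
rewrite single_seq_other by exact hn; exact (minus_zero_r (x n)).
Qed.

Lemma single_plus_rest (k : nat) (x : l1_sum X) :
  plus (single k (x k)) (rest k x) = x.
Proof.
apply l1_ext; intros n.
change (plus (single_seq k (x k) n) (rest k x n) = x n).
destruct (Nat.eq_dec n k) as [-> | hn].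
- rewrite single_seq_same, rest_same; apply plus_zero_r.
- rewrite single_seq_other, rest_other by exact hn; apply plus_zero_l.
Qed.

Lemma single_rest_l1_pair (k : nat) (x : l1_sum X) :
  l1_pair (single k (x k)) (rest k x).
Proof.
apply disjoint_l1_pair; intros n.
destruct (Nat.eq_dec n k) as [-> | hn].
- right; apply rest_same.
- left; exact (single_seq_other k (x k) n hn).
Qed.

Lemma rest_neq_zero (k m : nat) (x : l1_sum X) :
  m <> k -> x m <> zero -> rest k x <> zero.
Proof.
intros hm hx E; apply hx; rewrite <- (rest_other k x m hm), E; reflexivity.
Qed.

Lemma norm_eq_coordinate_plus_rest (k : nat) (x : l1_sum X) :
  norm x = norm (x k) + norm (rest k x).
Proof.
rewrite <- (norm_single k (x k)), <- (norm_l1_pair _ _ (single_rest_l1_pair k x)).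
f_equal; exact (eq_sym (single_plus_rest k x)).
Qed.

Lemma norm_coordinate_le_rest (k m : nat) (x : l1_sum X) :
  m <> k -> norm (x m) <= norm (rest k x).
Proof.
intros hm; rewrite <- (rest_other k x m hm); exact (norm_le_l1_norm _ m).
Qed.

(** * Left-symmetric points *)

Lemma l1_sum_not_left_symmetric (x : l1_sum X) :
  (forall n, nontrivial (X n)) -> x <> zero -> ~ left_symmetric x.
Proof.
intros hX hx.
destruct (classic (exists m, x m = zero)) as [[m hm] | hnz].
- destruct (hX m) as [w hw].
  apply (l1_pair_not_left_symmetric x (single m w)).
  + apply disjoint_l1_pair; intros n.
    destruct (Nat.eq_dec n m) as [-> | hn]; [now left |].
    right; exact (single_seq_other m w n hn).
  + exact hx.
  + now apply single_neq_zero.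
- assert (hn : forall n, x n <> zero) by (intros n E; apply hnz; now exists n).
  assert (Hk : forall k, norm (x k) <> norm (rest k x) -> ~ left_symmetric x).
  { intros k hk; rewrite <- (single_plus_rest k x).
    apply (l1_pair_plus_not_left_symmetric (single k (x k)) (rest k x)).
    - apply single_rest_l1_pair.
    - now apply single_neq_zero.
    - apply (rest_neq_zero k (S k)); auto.
    - now rewrite norm_single. }
  destruct (Req_dec (norm (x 0%nat)) (norm (rest 0 x))) as [E0 | ne];
    [| now apply (Hk 0%nat)].
  (* If coordinates 0 and 1 both balanced their rests, each would carry half of [norm x]; nothing
     would remain for coordinate 2. *)
  apply (Hk 1%nat); intros E1.
  pose proof (norm_eq_coordinate_plus_rest 0 x).
  pose proof (norm_eq_coordinate_plus_rest 1 x).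
  pose proof (norm_eq_coordinate_plus_rest 1 (rest 0 x)) as H1.
  rewrite rest_other in H1 by discriminate.
  pose proof (norm_coordinate_le_rest 1 2 (rest 0 x)) as H2.
  rewrite rest_other in H2 by discriminate.
  pose proof (norm_gt_0 _ (hn 2%nat)).
  specialize (H2 ltac:(discriminate)); lra.
Qed.

(** * Right-symmetric points *)

Lemma right_symmetric_l1_sum_support (x : l1_sum X) (k m : nat) :
  right_symmetric x -> m <> k -> x k <> zero -> x m = zero.
Proof.
intros hsym hmk hk; apply NNPP; intros hm.
(* Stated for arbitrary [i] and [j] so that whichever of [k] and [m] has the smaller norm can play
   the role of [u]. *)
assert (H : forall i j, j <> i -> x i <> zero -> ~ norm (x i) <= norm (x j)).
{ intros i j hji hi hle.
  apply (l1_pair_plus_not_right_symmetric (single i (x i)) (rest i x)).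
  - apply single_rest_l1_pair.
  - now apply single_neq_zero.
  - rewrite norm_single.
    apply Rle_trans with (1 := hle); now apply norm_coordinate_le_rest.
  - exact (eq_ind_r right_symmetric hsym (single_plus_rest i x)). }
destruct (Rle_or_lt (norm (x k)) (norm (x m))) as [hle | hlt].
- now apply (H k m).
- apply (H m k); auto; lra.
Qed.

Lemma eq_single (x : l1_sum X) (k : nat) :
  (forall n, n <> k -> x n = zero) -> x = single k (x k).
Proof.
intros hx; apply l1_ext; intros n; change (x n = single_seq k (x k) n).
destruct (Nat.eq_dec n k) as [-> | hn].
- now rewrite single_seq_same.
- rewrite single_seq_other by exact hn; auto.
Qed.

(** Forward, [single k] is an isometric embedding. Backward, the coordinates of [y] off [k] add the
    same [norm (rest k y)] to both sides of the orthogonality inequality, so it descends to [y k];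
    the conclusion lifts back because a coordinate norm is at most the l1 norm. *)
Lemma right_symmetric_single (k : nat) (v : X k) :
  right_symmetric (single k v) <-> right_symmetric v.
Proof.
split; intros hsym y hy l.
- assert (H : bj_orthogonal (single k y) (single k v))
    by (intros s; rewrite plus_single_scal, !norm_single; apply hy).
  pose proof (hsym _ H l) as Hl.
  now rewrite plus_single_scal, !norm_single in Hl.
- assert (H : bj_orthogonal (y k) v).
  { intros s; pose proof (hy s) as Hs.
    rewrite (norm_eq_coordinate_plus_rest k y) in Hs.
    assert (E : plus y (scal s (single k v))
                = plus (single k (plus (y k) (scal s v))) (rest k y)).
    { apply l1_ext; intros n.
      change (plus (y n) (scal s (single_seq k v n))
              = plus (single_seq k (plus (y k) (scal s v)) n) (rest k y n)).
      destruct (Nat.eq_dec n k) as [-> | hn].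
      - rewrite !single_seq_same, rest_same; symmetry; apply plus_zero_r.
      - rewrite !single_seq_other, rest_other, scal_zero_right by exact hn.
        apply plus_comm. }
    apply (f_equal (@norm K (l1_NormedModule X))) in E.
    rewrite (norm_plus_disjoint (single k _)), norm_single in E.
    { pose proof (Rge_trans _ _ _ (Req_ge _ _ (eq_sym E)) Hs); lra. }
    intros n; destruct (Nat.eq_dec n k) as [-> | hn].
    - right; apply rest_same.
    - left; exact (single_seq_other k _ n hn). }
  pose proof (hsym _ H l) as Hl.
  pose proof (norm_le_l1_norm (plus (single k v) (scal l y)) k) as Hk.
  rewrite norm_single; apply Rle_ge, Rle_trans with (2 := Hk), Rge_le.
  change (norm (plus (single_seq k v k) (scal l (y k))) >= norm v).
  rewrite single_seq_same; exact Hl.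
Qed.

Lemma right_symmetric_l1_sum (x : l1_sum X) :
  right_symmetric x <->
  exists k, (forall n, n <> k -> x n = zero) /\ right_symmetric (x k).
Proof.
split.
- intros hsym.
  assert (hsupp : exists k, forall n, n <> k -> x n = zero).
  { destruct (classic (exists k, x k <> zero)) as [[k hk] | hno].
    - exists k; intros n hn; now apply (right_symmetric_l1_sum_support x k n).
    (* Here [x] is zero, and index 0 is an arbitrary choice. *)
    - exists 0%nat; intros n _; apply NNPP; intros hn; apply hno; now exists n. }
  destruct hsupp as [k hk]; exists k; split; [exact hk |].
  apply right_symmetric_single; now rewrite <- eq_single.
- intros [k [hk hsym]].
  rewrite (eq_single x k hk); now apply right_symmetric_single.
Qed.

End L1SumSymmetry.
End NormedModuleFacts.

Theorem theorem22 (K : AbsRing) (hK : K = R_AbsRing \/ K = C_AbsRing)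
  (X : nat -> NormedModule K) (hX : forall n : nat, nontrivial (X n)) :
  (~ exists x : l1_sum X, x <> zero /\ left_symmetric x) /\
  (forall x : l1_sum X,
     right_symmetric x <->
     exists n0 : nat,
       (forall n : nat, n <> n0 -> x n = zero) /\ right_symmetric (x n0)).
Proof.
(* The case distinction between the two fields is confined to this step. *)
assert (H : abs_invertible K /\ exists iota : R -> K, real_embedding iota).
{ destruct hK as [-> | ->]; split.
  - exact abs_invertible_R.
  - eexists; exact real_embedding_R.
  - exact abs_invertible_C.
  - eexists; exact real_embedding_C. }
destruct H as [hinv [iota hiota]]; split.
- intros [x [hx hsym]]; now apply (l1_sum_not_left_symmetric hiota hinv x).
- intros x; exact (right_symmetric_l1_sum hinv x).
Qed.
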